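(* Let $s\in(0,1)$ and let $N\ge1$ be an integer with $N>2s$. Then $(-\Delta)^s$ has no eigenvalues in $\mathbb{R}^N$; that is, if $\mu\in\mathbb{R}$ and $u\in H^s(\mathbb{R}^N)$ are such that $$\int_{\mathbb{R}^N\times\mathbb{R}^N}\frac{(u(x)-u(y))(\varphi(x)-\varphi(y))}{|x-y|^{N+2s}}\,dx\,dy=\mu\int_{\mathbb{R}^N}u\varphi\,dx\quad\text{for all }\varphi\in H^s(\mathbb{R}^N),$$ then $u\equiv0$.
   Context: All functions are real-valued. $H^s(\mathbb{R}^N)$ is the space of $u\in L^2(\mathbb{R}^N)$ such that $\frac{|u(x)-u(y)|}{|x-y|^{N/2+s}}\in L^2(\mathbb{R}^N\times\mathbb{R}^N)$. The fractional Laplacian $(-\Delta)^s$ is defined, modulo a positive multiplicative constant depending on $N$ and $s$, as the Fourier multiplier with symbol $|\xi|^{2s}$; the constant is normalized so that its weak form is the double integral on the left-hand side of the identity in the claim. *)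

(* Defs.v *)
From HB Require Import structures.
From mathcomp Require Import all_boot all_order all_algebra.
From mathcomp Require Import all_classical all_reals all_analysis.

Set Implicit Arguments.
Unset Strict Implicit.
Unset Printing Implicit Defensive.

Import Order.TTheory GRing.Theory Num.Theory.
Import numFieldNormedType.Exports.

Local Open Scope classical_set_scope.
Local Open Scope ring_scope.

(** The Euclidean space of dimension [N] is [N.-tuple R], with the product
    sigma-algebra that MathComp-Analysis puts on tuples (= the Borel one);
    ['rV[R]_N] has no measurable structure and carries the sup norm. *)

Section lebesgue_measure_tuple.
Context (R : realType).

(* [lebesgue_measure] lives on [measurableTypeR R], which has the same
   measurable sets as [R] but a different display. *)
Definition consT n (p : measurableTypeR R * n.-tuple R) : n.+1.-tuple R :=
  [tuple of p.1 :: p.2].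

Lemma measurable_consT n : measurable_fun [set: _] (@consT n).
Proof.
apply: (@measurable_cons _ _ _ R (fst : measurableTypeR R * n.-tuple R -> R)
  n snd); [exact: measurable_fst|exact: measurable_snd].
Qed.

Section cons_measure.
Context n (mu : {sigma_finite_measure set (n.-tuple R) -> \bar R}).

Definition cons_measure : set (n.+1.-tuple R) -> \bar R :=
  pushforward (@lebesgue_measure R \x mu)%E (@consT n).

Let cons_measure0 : cons_measure set0 = 0%E.
Proof. by rewrite /cons_measure /pushforward preimage_set0 measure0. Qed.

Let cons_measure_ge0 A : (0 <= cons_measure A)%E.
Proof. by rewrite /cons_measure /pushforward measure_ge0. Qed.

Let measurable_preim A : measurable A -> measurable (@consT n @^-1` A).
Proof.
by move=> mA; rewrite -[X in measurable X]setTI; exact: measurable_consT.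
Qed.

Let cons_measure_sigma_additive : semi_sigma_additive cons_measure.
Proof.
move=> F mF tF mUF; rewrite /cons_measure /pushforward preimage_bigcup.
apply: measure_semi_sigma_additive.
- by move=> i; exact: measurable_preim.
- apply/trivIsetP => /= i j _ _ ij; rewrite -preimage_setI.
  by move/trivIsetP : tF => /(_ _ _ _ _ ij) ->//; rewrite preimage_set0.
- by rewrite -preimage_bigcup; exact: measurable_preim.
Qed.

HB.instance Definition _ := isMeasure.Build _ _ _ cons_measure
  cons_measure0 cons_measure_ge0 cons_measure_sigma_additive.

Let cons_measure_sigma_finite : sigma_finite setT cons_measure.
Proof.
pose g (t : n.+1.-tuple R) : measurableTypeR R * n.-tuple R :=
  (thead t, [tuple of behead t]).
have mg : measurable_fun [set: _] g.
  apply: measurable_fun_pair => /=; last exact: measurable_behead.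
  exact: (@measurable_tnth _ R n.+1 ord0).
have consTK : cancel (@consT n) g.
  by move=> [x t]; congr pair; rewrite /consT ?theadE//; exact/val_inj.
have /sigma_finiteP[F [TF ndF Foo]] := sigma_finiteT (@lebesgue_measure R).
have /sigma_finiteP[G [TG ndG Goo]] := sigma_finiteT mu.
exists (fun k => g @^-1` (F k `*` G k)) => [|k].
  rewrite -preimage_bigcup; apply/esym/seteqP; split => // t _ /=.
  have [i _ Fi] : (\bigcup_i F i) (thead t) by rewrite -TF.
  have [j _ Gj] : (\bigcup_i G i) [tuple of behead t] by rewrite -TG.
  exists (maxn i j) => //; split => /=.
    by move: Fi; exact/subsetPset/ndF/leq_maxl.
  by move: Gj; exact/subsetPset/ndG/leq_maxr.
have [mF Ffin] := Foo k; have [mG Gfin] := Goo k; split.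
  by rewrite -[X in measurable X]setTI; apply: mg => //; exact: measurableX.
rewrite /cons_measure /pushforward -comp_preimage (_ : g \o _ = id); last first.
  exact/funext.
by rewrite preimage_id product_measure1E// lte_mul_pinfty// ge0_fin_numE.
Qed.

HB.instance Definition _ := Measure_isSigmaFinite.Build _ _ _ cons_measure
  cons_measure_sigma_finite.

End cons_measure.

Fixpoint lebesgueT n : {sigma_finite_measure set (n.-tuple R) -> \bar R} :=
  match n with
  | 0 => \d_([tuple] : 0.-tuple R)
  | m.+1 => cons_measure (lebesgueT m)
  end.

Lemma lebesgueT_box n (A : 'I_n -> set R) :
  (forall i, measurable (A i)) ->
  lebesgueT n [set t | forall i, A i (tnth t i)] =
    (\prod_(i < n) lebesgue_measure (A i))%E.
Proof.
elim: n A => [|n IH] A mA.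
  rewrite big_ord0 /= diracE mem_set//; by case.
have mB : measurable [set t : n.-tuple R | forall i, A (lift ord0 i) (tnth t i)].
  rewrite [X in measurable X](_ : _ =
      \bigcap_(i in [set: 'I_n]) ((@tnth n R ^~ i) @^-1` A (lift ord0 i))).
    apply: fin_bigcap_measurable => [|i _]; first exact: finite_finset.
    by rewrite -[X in measurable X]setTI; exact: measurable_tnth.
  by apply/seteqP; split => t /= tA i; [move=> _|]; exact: tA.
have mA0 : measurable (A ord0 : set (measurableTypeR R)) := mA ord0.
rewrite big_ord_recl -IH//= /cons_measure /pushforward.
rewrite -(product_measure1E _ _ mA0 mB).
congr (_ _); apply/seteqP; split=> -[x t]/= xtA.
  split=> [|i]; first exact: (xtA ord0).
  by have := xtA (lift ord0 i); rewrite tnthS.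
move=> i; have [j ->|->] := unliftP ord0 i; last exact: xtA.1.
by rewrite tnthS; exact: xtA.2.
Qed.

End lebesgue_measure_tuple.

Definition eucl_dist (R : realType) N (x y : N.-tuple R) : R :=
  Num.sqrt (\sum_(i < N) (tnth x i - tnth y i) ^+ 2).

(* [Lfun] contains the measurability of its members. The value of the quotient
   on the diagonal (a null set for [N > 0]) is [0], as [0 / 0 = 0]. *)
Definition Hs (R : realType) N (s : R) : set (N.-tuple R -> R) :=
  [set u | u \in Lfun (lebesgueT R N) 2%:E /\
    (fun z : N.-tuple R * N.-tuple R =>
       `|u z.1 - u z.2| / eucl_dist z.1 z.2 `^ (N%:R / 2 + s))
      \in Lfun (lebesgueT R N \x lebesgueT R N)%E 2%:E].
Arguments Hs {R} N s.

(* Main.v *)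
Require Import Defs.
From HB Require Import structures.
From mathcomp Require Import all_boot all_order all_algebra.
From mathcomp Require Import all_classical all_reals all_analysis.
From mathcomp Require Import measurable_realfun.
From mathcomp Require Import ring lra.

(** Dilations replace the Fourier transform. With [u_l x = u (l x)] and [E] the
    bilinear form of the fractional Laplacian, [E u_l u] equals
    [mu <u, u_l>] by symmetry and [l^(2s) mu <u_l, u>] by homogeneity, so
    [u_l] is orthogonal to [u] whenever [mu != 0] and [l != 1]; hence the
    dilates of [u] are pairwise orthogonal. By Bessel's inequality,
    [<1_Q, u_l>] tends to [0] along a sequence [l_k -> 1] for every box [Q],
    whereas for [Q] around the origin it tends to the integral of [u] over [Q].
    These boxes form a pi-system generating the Borel sets, so [u = 0] a.e. If
    [mu = 0], then [E u u = 0] forces [u] to be a.e. constant, and a constant in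
    [L^2] of a space of infinite measure is [0]. *)

Set Implicit Arguments.
Unset Strict Implicit.
Unset Printing Implicit Defensive.

Import Order.TTheory GRing.Theory Num.Theory.
Import numFieldNormedType.Exports.

Local Open Scope classical_set_scope.
Local Open Scope ring_scope.

(** * Boxes around the origin: a pi-system generating the Borel sets *)

Section boxes.
Context {R : realType} {n : nat}.

Definition box (a b : 'I_n -> R) : set (n.-tuple R) :=
  [set t | forall i, tnth t i \in `]- a i, b i[].

(* Only boxes around the origin: these shrink into themselves under
   dilations by a factor less than [1]. *)
Definition boxes : set (set (n.-tuple R)) :=
  [set A | exists a b : 'I_n -> R,
    [/\ forall i, 0 < a i, forall i, 0 < b i & A = box a b]].

Lemma tuple_bounded (t : n.-tuple R) :
  exists k : nat, forall j, `|tnth t j| < k%:R.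
Proof.
exists (\max_j (Num.truncn `|tnth t j|).+1)%N => j.
rewrite (lt_le_trans (truncnS_gt _))// ler_nat.
exact: (leq_bigmax (F := fun j => (Num.truncn `|tnth t j|).+1)).
Qed.

Lemma box_measurable (a b : 'I_n -> R) : measurable (box a b).
Proof.
rewrite [X in measurable X](_ : _ =
    \bigcap_(i in [set: 'I_n]) ((@tnth n R ^~ i) @^-1` `]- a i, b i[%classic)).
  apply: fin_bigcap_measurable => [|i _]; first exact: finite_finset.
  by rewrite -[X in measurable X]setTI; exact: measurable_tnth.
by apply/seteqP; split => t /= tA i; [move=> _|]; exact: tA.
Qed.

Lemma boxes_box (a b : 'I_n -> R) :
  (forall i, 0 < a i) -> (forall i, 0 < b i) -> boxes (box a b).
Proof. by move=> a0 b0; exists a, b. Qed.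

Lemma boxes_measurable A : boxes A -> measurable A.
Proof. by move=> [a [b [_ _ ->]]]; exact: box_measurable. Qed.

Lemma boxes_setI : setI_closed boxes.
Proof.
move=> _ _ [a [b [a0 b0 ->]]] [c [d [c0 d0 ->]]].
exists (fun i => Num.min (a i) (c i)), (fun i => Num.min (b i) (d i)).
split=> [i|i|]; rewrite ?lt_min ?a0 ?b0 ?c0 ?d0//.
apply/seteqP; split=> t /= => [[ta tc] i|tac].
  have := ta i; have := tc i; rewrite !in_itv/= => /andP[? ?] /andP[? ?].
  by rewrite oppr_min lt_min gt_max; apply/andP; split; apply/andP.
split=> i; have := tac i; rewrite !in_itv/= oppr_min lt_min gt_max;
  by move=> /andP[/andP[? ?] /andP[? ?]]; apply/andP.
Qed.

(** The half-space is exhausted by boxes with bound [b] in direction [i] and all other bounds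
    growing. Since boxes contain the origin, [b] has to be positive. *)
Lemma boxes_tnth_lt (i : 'I_n) (b : R) : 0 < b ->
  <<s boxes >> [set t | tnth t i < b].
Proof.
move=> b0.
rewrite (_ : [set _ | _] = \bigcup_k
    box (fun=> k.+1%:R) (fun j => if j == i then b else k.+1%:R)).
  apply: sigma_algebra_bigcup => k; apply: sub_sigma_algebra.
  by apply: boxes_box => j //; case: ifP.
apply/seteqP; split=> t /=.
  move=> tb.
  have [k tk] := tuple_bounded t.
  have kk : (k%:R < k.+1%:R :> R) by rewrite ltr_nat.
  exists k => // j; rewrite /= in_itv/=.
  have /ltr_normlP[t1 t2] := tk j.
  rewrite ltrNl (lt_trans t1 kk)//=; case: eqVneq => [->//|_].
  by rewrite (lt_trans t2 kk).
by move=> [k _ /(_ i)] /=; rewrite in_itv/= eqxx => /andP[].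
Qed.

Lemma boxes_tnth_gt (i : 'I_n) (a : R) : 0 < a ->
  <<s boxes >> [set t | - a < tnth t i].
Proof.
move=> a0.
rewrite (_ : [set _ | _] = \bigcup_k
    box (fun j => if j == i then a else k.+1%:R) (fun=> k.+1%:R)).
  apply: sigma_algebra_bigcup => k; apply: sub_sigma_algebra.
  by apply: boxes_box => j //; case: ifP.
apply/seteqP; split=> t /=.
  move=> tb.
  have [k tk] := tuple_bounded t.
  have kk : (k%:R < k.+1%:R :> R) by rewrite ltr_nat.
  exists k => // j; rewrite /= in_itv/=.
  have /ltr_normlP[t1 t2] := tk j.
  rewrite (lt_trans t2 kk)//= andbT; case: eqVneq => [->//|_].
  by rewrite ltrNl (lt_trans t1 kk).
by move=> [k _ /(_ i)] /=; rewrite in_itv/= eqxx => /andP[].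
Qed.

Lemma boxes_measurableE : @measurable _ (n.-tuple R) = <<s boxes >>.
Proof.
apply/seteqP; split; last first.
  apply: smallest_sub; first exact: sigma_algebra_measurable.
  exact: boxes_measurable.
have : measurable_fun [set: g_sigma_algebraType boxes]
    (id : g_sigma_algebraType boxes -> n.-tuple R).
  apply/measurable_fun_tnthP => i.
  apply: (measurability _ (RGenOInfty.measurableE R)) => _ [_ [x ->] <-].
  rewrite setTI; have [x0|x0] := ltP x 0.
    rewrite (_ : _ @^-1` _ = [set t | - (- x) < tnth t i]); last first.
      by apply/seteqP; split => t; rewrite /= in_itv/= andbT opprK.
    by apply: boxes_tnth_gt; rewrite oppr_gt0.
  (* For [x >= 0] the half-space misses the origin. Its complement is closed and is cut out by open
     half-spaces with the positive bounds [x + 1/(k+1)]. *)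
  rewrite (_ : _ @^-1` _ = ~` \bigcap_k [set t | tnth t i < x + k.+1%:R^-1]).
    apply: measurableC; apply: bigcapT_measurable => k.
    by apply: boxes_tnth_lt; rewrite ltr_wpDl// invr_gt0.
  apply/seteqP; split => t; rewrite /= in_itv/= andbT.
    (* This index [k] satisfies [1/(k+1) <= tnth t i - x], so [t] violates the [k]-th bound. *)
    move=> xt /(_ (Num.truncn (tnth t i - x)^-1) I)/=.
    rewrite -ltrBlDl ltNge => /negP; apply.
    rewrite invf_ple ?posrE ?subr_gt0// ltW//; exact: truncnS_gt.
  apply: contra_notT; rewrite -leNgt => tx k _ /=.
  by rewrite (le_lt_trans tx)// ltrDl invr_gt0.
by move=> mid A mA; have := mid measurableT A mA; rewrite setTI.
Qed.

Lemma boxes_cover :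
  \bigcup_k box (fun=> k.+1%:R) (fun=> k.+1%:R) = [set: n.-tuple R].
Proof.
apply/seteqP; split => // t _.
have [k tk] := tuple_bounded t; exists k => // j.
have kk : (k%:R < k.+1%:R :> R) by rewrite ltr_nat.
by rewrite /= in_itv/= -ltr_norml (lt_trans (tk j) kk).
Qed.

(** The pi-lambda theorem, applied with the cubes of half-side [k+1], which cover the space and have
    finite mass. *)
Lemma boxes_measure_unique (m1 m2 : {measure set (n.-tuple R) -> \bar R}) :
  (forall A, boxes A -> (m1 A < +oo)%E) ->
  (forall A, boxes A -> m1 A = m2 A) ->
  forall A, measurable A -> m1 A = m2 A.
Proof.
move=> m1oo m12 A mA.
have G k : boxes (box (fun=> k.+1%:R) (fun=> k.+1%:R)).
  exact: boxes_box.
apply: (measure_unique boxes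
  (fun k => box (fun=> k.+1%:R) (fun=> k.+1%:R))) => //.
- exact: boxes_measurableE.
- exact: boxes_setI.
- exact: boxes_cover.
- by move=> k; exact: m1oo.
Qed.

End boxes.

(** * Change of variables under a map that rescales measure by a constant *)

Section change_of_variables.
Local Open Scope ereal_scope.
Context d1 d2 (X : measurableType d1) (Y : measurableType d2) (R : realType).
Context (mu : {measure set X -> \bar R}) (nu : {measure set Y -> \bar R}).
Context (phi : X -> Y) (mphi : measurable_fun [set: X] phi) (c : R).
Hypothesis c0 : (0 < c)%R.
Hypothesis muphi : forall A, measurable A -> mu (phi @^-1` A) = c%:E * nu A.

Lemma ge0_integral_comp (f : Y -> \bar R) : measurable_fun [set: Y] f ->
  (forall y, 0 <= f y) -> \int[mu]_x f (phi x) = c%:E * \int[nu]_y f y.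
Proof.
move=> mf f0.
have := @ge0_integral_pushforward _ _ X Y R phi mphi mu setT f measurableT mf.
rewrite preimage_setT => /(_ (fun y _ => f0 y)) <-.
rewrite [LHS](eq_measure_integral (mscale (NngNum (ltW c0)) nu)).
  by rewrite ge0_integral_mscale.
by move=> A mA _; rewrite /= /pushforward muphi.
Qed.

(** Apply the nonnegative case to both parts of [f]. Integrability is not assumed: as [c > 0],
    multiplication by [c] commutes with the subtraction even when parts are infinite. *)
Lemma integral_comp (f : Y -> \bar R) : measurable_fun [set: Y] f ->
  \int[mu]_x f (phi x) = c%:E * \int[nu]_y f y.
Proof.
move=> mf; rewrite [LHS]integralE [in RHS]integralE.
under [X in X - _]eq_integral do rewrite (funepos_comp f phi)/=.
under [X in _ - X]eq_integral do rewrite (funeneg_comp f phi)/=.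
rewrite (ge0_integral_comp (measurable_funepos mf) (funepos_ge0 f)).
rewrite (ge0_integral_comp (measurable_funeneg mf) (funeneg_ge0 f)).
have : 0 <= \int[nu]_x f^\+ x by exact: integral_ge0.
have : 0 <= \int[nu]_x f^\- x by exact: integral_ge0.
move: (\int[nu]_x f^\+ x) (\int[nu]_x f^\- x) => [x| |] [y| |]// _ _.
- by congr EFin; rewrite mulrBr.
all: by rewrite ?gt0_muley ?gt0_muleNy ?lte_fin.
Qed.

End change_of_variables.

(** * Dilations and Lebesgue measure *)

Section dilation.
Context {R : realType} {n : nat}.
Implicit Types l : R.

Definition dilation l (t : n.-tuple R) : n.-tuple R :=
  [tuple l * tnth t i | i < n].

Lemma measurable_dilation l : measurable_fun [set: n.-tuple R] (dilation l).
Proof.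
apply/measurable_fun_tnthP => i.
rewrite (_ : _ \o _ = fun t => l * tnth t i); last first.
  by apply/funext => t /=; rewrite tnth_mktuple.
by apply: measurable_funM => //; exact: measurable_tnth.
Qed.

Lemma dilationM l m t : dilation l (dilation m t) = dilation (l * m) t.
Proof. by apply: eq_from_tnth => i; rewrite !tnth_mktuple mulrA. Qed.

Lemma dilation1 t : dilation 1 t = t.
Proof. by apply: eq_from_tnth => i; rewrite !tnth_mktuple mul1r. Qed.

Lemma eucl_dist_dilation l (x y : n.-tuple R) : 0 <= l ->
  eucl_dist (dilation l x) (dilation l y) = l * eucl_dist x y.
Proof.
move=> l0; rewrite /eucl_dist.
under eq_bigr do rewrite !tnth_mktuple -mulrBr exprMn.
by rewrite -mulr_sumr sqrtrM ?sqr_ge0// sqrtr_sqr ger0_norm.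
Qed.

Lemma dilation_box l (a b : 'I_n -> R) : 0 < l ->
  dilation l @^-1` box a b = box (fun i => a i / l) (fun i => b i / l).
Proof.
move=> l0; apply/seteqP; split => t /= tab i; have := tab i;
  by rewrite !in_itv/= tnth_mktuple -mulNr ltr_pdivrMr// ltr_pdivlMr// mulrC.
Qed.

Lemma lebesgueT_boxE (a b : 'I_n -> R) :
  (forall i, 0 < a i) -> (forall i, 0 < b i) ->
  lebesgueT R n (box a b) = (\prod_(i < n) (a i + b i))%:E.
Proof.
move=> a0 b0.
rewrite (lebesgueT_box (A := fun i => `]- a i, b i[%classic))//.
rewrite -prodEFin; apply: eq_bigr => i _.
rewrite lebesgue_measure_itv/= lte_fin (@lt_trans _ _ 0) ?oppr_lt0//.
by rewrite -EFinD opprK addrC.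
Qed.

Lemma lebesgueT_boxes_lty A : boxes A -> (lebesgueT R n A < +oo)%E.
Proof. by move=> [a [b [a0 b0 ->]]]; rewrite lebesgueT_boxE// ltry. Qed.

(** Both sides are measures in [A], finite on boxes, where they agree because the preimage of a box
    has each side divided by [l]. *)
Lemma lebesgueT_dilation l A : 0 < l -> measurable A ->
  lebesgueT R n (dilation l @^-1` A) = ((l ^+ n)^-1%:E * lebesgueT R n A)%E.
Proof.
move=> l0 mA.
have c0 : 0 <= (l ^+ n)^-1 by rewrite invr_ge0 exprn_ge0// ltW.
(* The instance takes the measurability proof as an argument, which unification
   cannot recover from the function alone: hence the explicit name. *)
pose m1 : {measure set (n.-tuple R) -> \bar R} :=
  measure_function_pushforward__canonical__measure_function_Measure
    (lebesgueT R n) (measurable_dilation l).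
have bE B : boxes B ->
    lebesgueT R n (dilation l @^-1` B) = ((l ^+ n)^-1%:E * lebesgueT R n B)%E.
  move=> [a [b [a0 b0 ->]]]; rewrite dilation_box//.
  rewrite !lebesgueT_boxE// => [|i|i]; rewrite ?divr_gt0//.
  rewrite -EFinM; congr EFin.
  under eq_bigr do rewrite -mulrDl.
  by rewrite big_split/= prodr_const card_ord exprVn mulrC.
apply: (@boxes_measure_unique _ _ m1
  (mscale (NngNum c0) (lebesgueT R n))) => //.
  move=> B BB; rewrite /m1/= /pushforward bE// lte_mul_pinfty//.
  exact: lebesgueT_boxes_lty.
Qed.

End dilation.

(** * Square-integrable functions *)

Section Lfun2.
Context d (T : measurableType d) (R : realType).
Context (mu : {measure set T -> \bar R}).

Lemma Lfun_measurable p (f : T -> R) : f \in Lfun mu p ->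
  measurable_fun [set: T] f.
Proof. by rewrite inE => /andP[/[!inE]]. Qed.

Lemma Lfun2P (f : T -> R) : f \in Lfun mu 2%:E <->
  measurable_fun [set: T] f /\ (\int[mu]_x (f x ^+ 2)%:E < +oo)%E.
Proof.
split=> [f2|[mf f2]].
  split; first exact: Lfun_measurable f2.
  have /integrableP[_] := Lfun2_integrable_sqr f2.
  by under eq_integral do rewrite /= ger0_norm ?sqr_ge0//.
rewrite inE; apply/andP; split; rewrite inE//= /finite_norm unlock.
apply: poweR_lty; under eq_integral => x _ do
  rewrite /= powR_mulrn// -normrX ger0_norm ?sqr_ge0//.
by [].
Qed.

Lemma Lfun2_mul_integrable (f g : T -> R) :
  f \in Lfun mu 2%:E -> g \in Lfun mu 2%:E ->
  mu.-integrable [set: T] (fun x => (f x * g x)%:E).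
Proof. by move=> f2 g2; exact/Lfun1_integrable/Lfun2_mul_Lfun1. Qed.

End Lfun2.

Lemma Lfun2_comp d1 d2 (X : measurableType d1) (Y : measurableType d2)
    (R : realType) (mu : {measure set X -> \bar R})
    (nu : {measure set Y -> \bar R}) (phi : X -> Y) (c : R) (f : Y -> R) :
  measurable_fun [set: X] phi -> 0 < c ->
  (forall A, measurable A -> mu (phi @^-1` A) = c%:E * nu A)%E ->
  f \in Lfun nu 2%:E -> f \o phi \in Lfun mu 2%:E.
Proof.
move=> mphi c0 muphi /Lfun2P[mf f2]; apply/Lfun2P; split.
  exact: measurableT_comp.
have mf2 : measurable_fun [set: Y] (fun y => (f y ^+ 2)%:E).
  by apply/measurable_EFinP; exact: measurable_funX.
by rewrite (integral_comp mphi c0 muphi mf2) lte_mul_pinfty ?lee_fin ?ltW.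
Qed.

(** * Simultaneous dilation of both variables *)

Section dilation_product.
Context {R : realType} {n : nat}.
Local Notation nu := (lebesgueT R n).

Definition dilation2 (l : R) (z : n.-tuple R * n.-tuple R) :=
  (dilation l z.1, dilation l z.2).

Lemma measurable_dilation2 l : measurable_fun [set: _] (dilation2 l).
Proof.
apply: measurable_fun_pair; apply: measurableT_comp => //;
  apply: measurable_dilation => //.
Qed.

Lemma lebesgueT2_dilation l A : 0 < l -> measurable A ->
  ((nu \x nu) (dilation2 l @^-1` A) =
   ((l ^+ n)^-1 ^+ 2)%:E * (nu \x nu) A)%E.
Proof.
move=> l0 mA; have c0 : 0 <= (l ^+ n) ^+ 2 by rewrite sqr_ge0.
have ln0 : l ^+ n != 0 by rewrite expf_neq0// gt_eqF.
pose m1 : {measure set _ -> \bar R} :=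
  measure_function_pushforward__canonical__measure_function_Measure
    (nu \x nu)%E (measurable_dilation2 l).
(* The pushforward, multiplied by [(l ^+ n) ^+ 2], has the values of the product measure on
   rectangles, hence equals it. *)
rewrite [in RHS](@product_measure_unique _ _ _ _ _ nu nu
  (mscale (NngNum c0) m1))//.
  rewrite /= /mscale/= /pushforward muleA -EFinM -exprMn mulVf//.
  by rewrite expr1n mul1e.
move=> B C mB mC; rewrite /= /mscale/= /pushforward.
have mdil D : measurable D ->
    measurable (dilation l @^-1` D : set (n.-tuple R)).
  move=> mD; rewrite -[X in measurable X]setTI.
  apply: measurable_dilation => //.
rewrite (_ : _ @^-1` _ = (dilation l @^-1` B) `*` (dilation l @^-1` C))//.
rewrite product_measure1E; [|exact: mdil|exact: mdil].
have cc (x y : \bar R) : (((l ^+ n) ^+ 2)%:E *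
    ((l ^+ n)^-1%:E * x * ((l ^+ n)^-1%:E * y)) = x * y)%E.
  rewrite muleACA [LHS]muleA -!EFinM -[RHS]mul1e; congr (_%:E * _)%E.
  by rewrite -expr2 -exprMn divff// expr1n.
rewrite -[RHS]cc; congr (_ * (_ * _))%E; exact: lebesgueT_dilation.
Qed.

End dilation_product.

(** * The energy form and its homogeneity *)

Section energy.
Context {R : realType} {N : nat}.
Local Notation nu := (lebesgueT R N).
Implicit Types (u v : N.-tuple R -> R) (s l : R).

Lemma eucl_dist_ge0 (x y : N.-tuple R) : 0 <= eucl_dist x y.
Proof. exact: sqrtr_ge0. Qed.

Lemma eucl_dist_eq0 (x y : N.-tuple R) : eucl_dist x y = 0 -> x = y.
Proof.
move/eqP; rewrite sqrtr_eq0 => xy.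
have /eqP : \sum_(i < N) (tnth x i - tnth y i) ^+ 2 = 0.
  by apply/le_anti; rewrite xy sumr_ge0// => i _; exact: sqr_ge0.
rewrite psumr_eq0 => [/allP xy0|i _]; last exact: sqr_ge0.
apply: eq_from_tnth => i; apply/eqP; rewrite -subr_eq0 -sqrf_eq0.
by apply: xy0; rewrite mem_index_enum.
Qed.

Lemma measurable_eucl_dist :
  measurable_fun [set: _]
    (fun z : N.-tuple R * N.-tuple R => eucl_dist z.1 z.2).
Proof.
rewrite (_ : (fun _ => _) = (fun z : N.-tuple R * N.-tuple R =>
    (\sum_(i < N) (tnth z.1 i - tnth z.2 i) ^+ 2) `^ 2^-1)); last first.
  apply/funext => z; rewrite powR12_sqrt// sumr_ge0// => i _; exact: sqr_ge0.
apply: (measurableT_comp (measurable_powR _)).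
apply: measurable_sum => i; apply: measurable_funX; apply: measurable_funB.
- by apply: (measurableT_comp (measurable_tnth i)).
- by apply: (measurableT_comp (measurable_tnth i)).
Qed.

Definition energy_density s u v (z : N.-tuple R * N.-tuple R) : R :=
  (u z.1 - u z.2) * (v z.1 - v z.2) / eucl_dist z.1 z.2 `^ (N%:R + 2 * s).

Lemma energy_densityC s u v : energy_density s u v = energy_density s v u.
Proof. by apply/funext => z; rewrite /energy_density [X in X / _]mulrC. Qed.

Lemma measurable_energy_density s u v :
  measurable_fun [set: _] u -> measurable_fun [set: _] v ->
  measurable_fun [set: _] (energy_density s u v).
Proof.
move=> mu mv; rewrite /energy_density.
under eq_fun do rewrite -powRN.
apply: measurable_funM.
  by apply: measurable_funM; apply: measurable_funB; apply: measurableT_comp.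
exact: (measurableT_comp (measurable_powR _) measurable_eucl_dist).
Qed.

(** In absolute value the density is the product of the difference quotients of [u] and [v], both in
    L^2 by definition of [Hs]. *)
Lemma integrable_energy_density s u v : (1 <= N)%N -> 0 < s ->
  Hs N s u -> Hs N s v ->
  (nu \x nu)%E.-integrable [set: _] (EFin \o energy_density s u v).
Proof.
move=> N1 s0 [u2 gu2] [v2 gv2].
have := Lfun2_mul_integrable gu2 gv2; apply: le_integrable => //.
  apply/measurable_EFinP; apply: measurable_energy_density.
    exact: Lfun_measurable u2.
  exact: Lfun_measurable v2.
move=> z _ /=; rewrite lee_fin !normrM !normfV !normr_id mulrACA -invfM.
(* The distance vanishes on the diagonal, where exponents add up only if their sum is nonzero; here
   it is positive. *)
rewrite !(ger0_norm (powR_ge0 _ _)) -powRD; last first.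
  apply/implyP => /eqP; have : (1 <= N%:R :> R) by rewrite ler1n. lra.
by rewrite (_ : N%:R / 2 + s + (N%:R / 2 + s) = N%:R + 2 * s)//; field.
Qed.

Lemma energy_density_dilation s u v l z : 0 < l ->
  energy_density s (u \o dilation l) (v \o dilation l) z =
  l `^ (N%:R + 2 * s) * energy_density s u v (dilation2 l z).
Proof.
move=> l0; rewrite /energy_density/= eucl_dist_dilation ?(ltW l0)//.
rewrite powRM ?(ltW l0) ?eucl_dist_ge0// invfM [RHS]mulrCA mulVKf//.
by rewrite gt_eqF ?powR_gt0.
Qed.

(** The difference quotient of the dilate is [l] to the power [N/2 + s] times that of [u], composed
    with [dilation2 l]. *)
Lemma Hs_dilation s u l : 0 < l -> Hs N s u -> Hs N s (u \o dilation l).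
Proof.
move=> l0 [u2 gu2]; split.
  apply: (Lfun2_comp (measurable_dilation l) _ _ u2); last first.
    by move=> A mA; exact: lebesgueT_dilation.
  by rewrite invr_gt0 exprn_gt0.
have ln0 : 0 < (l ^+ N)^-1 ^+ 2 by rewrite exprn_gt0// invr_gt0 exprn_gt0.
have := Lfun2_comp (measurable_dilation2 l) ln0 _ gu2.
move=> /(_ (nu \x nu)%E (fun A mA => lebesgueT2_dilation l0 mA)).
move=> /(Lfun_scale (l `^ (N%:R / 2 + s)) (ler1n _ 2)).
set f := (X in X \in _); set g := (X in _ -> is_true (X \in _)).
suff -> : f = g by []; apply/funext => z; rewrite /f /g /=.
rewrite eucl_dist_dilation ?(ltW l0)// powRM ?(ltW l0) ?eucl_dist_ge0//.
rewrite invfM -[LHS]mulrA [X in _ * X = _]mulrC mulVKf//.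
by rewrite gt_eqF ?powR_gt0.
Qed.

End energy.

(** * Bessel's inequality for a bounded orthogonal sequence *)

Section bessel.
Context d (T : measurableType d) (R : realType).
Context (mu : {measure set T -> \bar R}).
Implicit Types f g h : T -> R.
Local Notation L2 := (Lfun mu 2%:E).

Definition inner f g : R := \int[mu]_x (f x * g x).

Lemma innerC f g : inner f g = inner g f.
Proof. by apply: eq_Rintegral => x _; rewrite mulrC. Qed.

Lemma inner_ge0 f : 0 <= inner f f.
Proof. by apply: Rintegral_ge0 => x _; rewrite -expr2 sqr_ge0. Qed.

Lemma Lfun2_subZ f g (c : R) : f \in L2 -> g \in L2 ->
  (fun x => f x - c * g x) \in L2.
Proof.
move=> f2 g2.
have g2' : - c \o* g \in L2 by apply: Lfun_scale g2; rewrite ler1n.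
rewrite (_ : (fun _ => _) = f + (- c \o* g)).
  exact: (@Lfun_addr_closed _ _ _ mu 2%:E (lee1n 2)).2 f2 g2'.
by apply/funext => x; rewrite [RHS]/(f x + g x * - c) mulrN mulrC.
Qed.

Lemma inner_subZl f g h (c : R) : f \in L2 -> g \in L2 -> h \in L2 ->
  inner (fun x => f x - c * g x) h = inner f h - c * inner g h.
Proof.
move=> f2 g2 h2; rewrite /inner.
have fh := Lfun2_mul_integrable f2 h2.
have gh := Lfun2_mul_integrable g2 h2.
rewrite -RintegralZl// -RintegralB//.
  by apply: eq_Rintegral => x _; rewrite mulrBl mulrA.
by apply: eq_integrable (integrableZl measurableT c gh).
Qed.

(** Removing from [f] its components along the [e i] one at a time leaves remainders of nonnegative
    square norm. This bounds the sum of the squared coefficients, so these tend to zero. *)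
Lemma bessel_cvg0 f (e : nat -> T -> R) (C : R) : f \in L2 ->
  (forall i, e i \in L2) ->
  (forall i j, i != j -> inner (e i) (e j) = 0) ->
  (forall i, inner (e i) (e i) <= C) ->
  (fun i => inner f (e i)) @ \oo --> 0.
Proof.
move=> f2 e2 eij eC0.
(* The maximum with [1] makes the bound positive, as it serves as a divisor. *)
pose D := Num.max C 1.
have D0 : 0 < D by rewrite lt_max ltr01 orbT.
have eC i : inner (e i) (e i) <= D by rewrite le_max eC0.
pose a i := inner f (e i).
(* The coefficient [a k / D] instead of [a k / <e k, e k>] avoids a case
   distinction on the vanishing of [e k]. *)
pose r := fix r k :=
  if k is k'.+1 then fun x => r k' x - a k' / D * e k' x else f.
have r2 k : r k \in L2 by elim: k => //= k ?; exact: Lfun2_subZ.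
(* Up to stage [k] only multiples of [e i] with [i < k] are removed, all orthogonal to [e j]. *)
have ra k j : (k <= j)%N -> inner (r k) (e j) = a j.
  elim: k => //= k IH kj; rewrite inner_subZl// IH ?(ltnW kj)//.
  by rewrite eij ?mulr0 ?subr0// ltn_eqF.
have rr k : inner (r k) (r k) <= inner f f - \sum_(0 <= i < k) a i ^+ 2 / D.
  elim: k => [|k IH]; first by rewrite big_geq// subr0.
  rewrite inner_subZl// [inner (r k) _]innerC [inner (e k) _]innerC.
  rewrite !inner_subZl// [inner (e k) (r k)]innerC ra// big_nat_recr//=.
  (* Expanding the square gives a cross term [- 2 * a k ^+ 2 / D] and this quadratic term, which
     costs at most half of that gain. *)
  have : a k ^+ 2 / D / D * inner (e k) (e k) <= a k ^+ 2 / D.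
    rewrite -mulrA ler_piMr ?divr_ge0 ?sqr_ge0 ?(ltW D0)//.
    by rewrite mulrC ler_pdivrMr// mul1r.
  lra.
have sumle k : \sum_(0 <= i < k) a i ^+ 2 / D <= inner f f.
  by rewrite -subr_ge0 (le_trans (inner_ge0 (r k))).
have : (fun i => a i ^+ 2 / D) @ \oo --> 0.
  apply: cvg_series_cvg_0; apply: nondecreasing_is_cvgn.
    by apply: nondecreasing_series => i _ _; rewrite divr_ge0 ?sqr_ge0 ?ltW.
  by exists (inner f f) => _ [k _ <-]; exact: sumle.
move=> /(cvgM (cvg_cst D)); rewrite mulr0 => aD.
have {aD} : (fun i => a i ^+ 2) @ \oo --> 0.
  rewrite (_ : (fun i => _) = cst D \* (fun i => a i ^+ 2 / D))//.
  by apply/funext => i /=; rewrite mulrC mulfVK// gt_eqF.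
move=> /(continuous_cvg _ (@sqrt_continuous R 0)).
rewrite sqrtr0 => /= sa; apply/norm_cvg0P.
by under eq_fun do rewrite -sqrtr_sqr.
Qed.

End bessel.

Lemma Rintegral_comp d1 d2 (X : measurableType d1) (Y : measurableType d2)
    (R : realType) (mu : {measure set X -> \bar R})
    (nu : {measure set Y -> \bar R}) (phi : X -> Y) (c : R) (f : Y -> R) :
  measurable_fun [set: X] phi -> 0 < c ->
  (forall A, measurable A -> mu (phi @^-1` A) = c%:E * nu A)%E ->
  measurable_fun [set: Y] f ->
  \int[mu]_x f (phi x) = c * \int[nu]_y f y.
Proof.
move=> mphi c0 muphi mf; rewrite /Rintegral.
have mEf : measurable_fun [set: Y] (EFin \o f) by exact/measurable_EFinP.
rewrite (integral_comp mphi c0 muphi mEf).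
by case: integral => [r| |]//=; rewrite ?gt0_muley ?gt0_muleNy ?lte_fin ?mulr0.
Qed.

(** * Orthogonality of the dilates of an eigenfunction *)

Section eigenfunction.
Context {R : realType} {N : nat} (s : R) (N1 : (1 <= N)%N) (s0 : 0 < s).
Context (mu : R) (mu0 : mu != 0) (u : N.-tuple R -> R) (hu : Hs N s u).
Local Notation nu := (lebesgueT R N).
Hypothesis weak : forall phi, Hs N s phi ->
  \int[(nu \x nu)%E]_z energy_density s u phi z = mu * inner nu u phi.

Let L2u : u \in Lfun nu 2%:E. Proof. by case: hu. Qed.

Lemma Lfun2_dilation l : 0 < l -> u \o dilation l \in Lfun nu 2%:E.
Proof. by move=> l0; case: (Hs_dilation l0 hu). Qed.

Lemma inner_dilation l (f g : N.-tuple R -> R) : 0 < l ->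
  measurable_fun [set: _] f -> measurable_fun [set: _] g ->
  inner nu (f \o dilation l) (g \o dilation l) = (l ^+ N)^-1 * inner nu f g.
Proof.
move=> l0 mf mg.
apply: (Rintegral_comp (f := fun x => f x * g x) (measurable_dilation l)).
- by rewrite invr_gt0 exprn_gt0.
- by move=> A mA; exact: lebesgueT_dilation.
- exact: measurable_funM.
Qed.

(** The hypothesis [weak] is used twice, with test functions [u \o dilation l] and [v]. Since
    [u = v \o dilation l], scaling turns the first energy into that of [u] and [v], with factor [l]
    to the power [2 * s - N]; passing from [inner nu u v] back to [inner nu (u \o dilation l) u]
    absorbs the [- N]. *)
Lemma eigenfunction_orthogonal l : 0 < l -> l != 1 ->
  inner nu (u \o dilation l) u = 0.
Proof.
move=> l0 l1; pose v := u \o dilation l^-1.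
have li0 : 0 < l^-1 by rewrite invr_gt0.
have hv : Hs N s v by exact: Hs_dilation.
have mu' := Lfun_measurable L2u.
have mv : measurable_fun [set: _] v by exact: Lfun_measurable hv.1.
have vu : v \o dilation l = u.
  by apply/funext => x; rewrite /v/= dilationM mulVf ?gt_eqF// dilation1.
have innerE : inner nu (u \o dilation l) u = (l ^+ N)^-1 * inner nu u v.
  by rewrite -inner_dilation// vu.
have energyE : mu * inner nu u (u \o dilation l) =
    l `^ (2 * s) * (mu * inner nu (u \o dilation l) u).
  rewrite -weak; last exact: Hs_dilation.
  rewrite energy_densityC -[X in energy_density _ _ X]vu.
  under eq_Rintegral do rewrite energy_density_dilation//.
  pose K z := l `^ (N%:R + 2 * s) * energy_density s u v z.
  rewrite (@Rintegral_comp _ _ _ _ _ (nu \x nu)%E (nu \x nu)%E (dilation2 l)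
    ((l ^+ N)^-1 ^+ 2) K).
  - rewrite RintegralZl//; last exact: integrable_energy_density.
    rewrite weak// innerE powRD; last first.
      by apply/implyP => _; rewrite gt_eqF.
    rewrite powR_mulrn ?ltW//; field.
    by rewrite expf_neq0// gt_eqF.
  - exact: measurable_dilation2.
  - by rewrite exprn_gt0// invr_gt0 exprn_gt0.
  - by move=> A mA; exact: lebesgueT2_dilation.
  - by apply: measurable_funM => //; exact: measurable_energy_density.
have ls : l `^ (2 * s) != 1.
  apply: contra l1 => /eqP /(congr1 (@ln R)); rewrite ln_powR ln1 => /eqP.
  by rewrite !mulf_eq0 (gt_eqF s0) pnatr_eq0/= ln_eq0.
move: energyE; rewrite innerC; move: (inner _ _ _) => x /eqP.
rewrite eq_sym -subr_eq0 -[X in _ - X]mul1r -mulrBl !mulf_eq0 subr_eq0.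
by rewrite (negbTE ls) (negbTE mu0) => /eqP.
Qed.

(** Undoing the dilation by [m] in both factors reduces to the ratio [l / m], which differs from
    [1]. *)
Lemma eigenfunction_orthogonal2 l m : 0 < l -> 0 < m -> l != m ->
  inner nu (u \o dilation l) (u \o dilation m) = 0.
Proof.
move=> l0 m0 lm; have mu' := Lfun_measurable L2u.
have lm0 : 0 < l / m by rewrite divr_gt0.
rewrite (_ : u \o dilation l = (u \o dilation (l / m)) \o dilation m).
  rewrite inner_dilation// ?eigenfunction_orthogonal ?mulr0//.
    by rewrite -(inj_eq (mulIf (lt0r_neq0 m0))) mulfVK ?mul1r// gt_eqF.
  exact: Lfun_measurable (Lfun2_dilation lm0).
by apply/funext => x /=; rewrite dilationM mulfVK// gt_eqF.
Qed.

End eigenfunction.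

(** * Measures given by a density *)

Section integral_measure.
Context d (T : measurableType d) (R : realType).
Context (mu : {measure set T -> \bar R}).
Context (f : T -> \bar R) (mf : measurable_fun [set: T] f).
Hypothesis f0 : (forall x, 0 <= f x)%E.

Let m (A : set T) : \bar R := (\int[mu]_(x in A) f x)%E.

Let m0 : m set0 = 0%E. Proof. exact: integral_set0. Qed.

Let m_ge0 A : (0 <= m A)%E. Proof. exact: integral_ge0. Qed.

Let m_sigma_additive : semi_sigma_additive m.
Proof.
move=> F mF tF mUF; rewrite /m ge0_integral_bigcup//.
  apply: is_cvg_ereal_nneg_natsum_cond => k _ _.
  exact: integral_ge0.
exact: measurable_funTS.
Qed.

HB.instance Definition _ := isMeasure.Build _ _ _ m m0 m_ge0 m_sigma_additive.

(** The existential form yields bundled measures for two densities at once, the positive and the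
    negative part of a function. *)
Lemma integral_measure : exists nu : {measure set T -> \bar R},
  forall A, nu A = (\int[mu]_(x in A) f x)%E.
Proof. by exists (m : {measure set T -> \bar R}). Qed.

End integral_measure.

(** * Vanishing of box integrals, by Bessel and dominated convergence *)

Section box_integrals.
Context {R : realType} {n : nat}.
Local Notation nu := (lebesgueT R n).

(** The measures with densities the positive and the negative part of [u] are finite and equal on
    boxes, hence equal everywhere. One vanishes on [P], the other off [P], so both are zero and so
    is the integral of [|u|]. *)
Lemma box_integral_eq0_ae (u : n.-tuple R -> R) :
  measurable_fun [set: _] u ->
  (forall Q, boxes Q -> nu.-integrable Q (EFin \o u)) ->
  (forall Q, boxes Q -> \int[nu]_(x in Q) (u x)%:E = 0)%E ->
  {ae nu, forall x, u x = 0}.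
Proof.
move=> mu iu u0; pose v := EFin \o u.
have mv : measurable_fun [set: _] v by exact/measurable_EFinP.
have mvp := measurable_funepos mv; have mvn := measurable_funeneg mv.
have [mp mpE] := integral_measure nu mvp (funepos_ge0 _).
have [mn mnE] := integral_measure nu mvn (funeneg_ge0 _).
have pnE A : measurable A -> mp A = mn A.
  apply: boxes_measure_unique => {}A BA; rewrite mpE.
    have := integrable_pos_fin_num (boxes_measurable BA) (iu _ BA).
    by rewrite ge0_fin_numE// integral_ge0.
  rewrite mnE.
  rewrite -[LHS](subeK _ (integrable_neg_fin_num (boxes_measurable BA) (iu _ BA))).
  by rewrite -integralE u0// add0e.
pose P := [set x | 0 < u x].
have mP : measurable P.
  rewrite -[P]setTI (_ : P = u @^-1` `]0, +oo[); first exact: mu.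
  by apply/seteqP; split => x; rewrite /P/= in_itv/= andbT.
have mnP : mn P = 0%E.
  rewrite mnE; apply: integral0_eq => x Px.
  by rewrite funenegE; apply/max_idPr; rewrite lee_fin oppr_le0 ltW.
have mpCP : mp (~` P) = 0%E.
  rewrite mpE; apply: integral0_eq => x /negP; rewrite -leNgt => ux.
  by rewrite funeposE; apply/max_idPr; rewrite lee_fin.
have mpT : mp setT = 0%E.
  rewrite -(setUv P); apply: null_set_setU => //; first exact: measurableC.
  by rewrite pnE.
have := ae_eq_integral_abs nu measurableT mv.
have -> : (\int[nu]_x `|v x| = 0)%E.
  under eq_integral => x _ do rewrite -[`|v x|%E]/((abse \o v) x) fune_abse.
  by rewrite ge0_integralD// -mpE -mnE -pnE// mpT adde0.
move=> [/(_ erefl) vae _]; apply: filterS vae => x /(_ I) [].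
by [].
Qed.

Implicit Types (u : n.-tuple R -> R) (Q : set (n.-tuple R)).

Lemma boxes_shrink Q (m : R) t : boxes Q -> 1 <= m -> Q (dilation m t) -> Q t.
Proof.
move=> [a [b [a0 b0 ->]]] m1 tQ i; have := tQ i.
rewrite !in_itv/= tnth_mktuple => /andP[am mb].
by have := a0 i; have := b0 i; nra.
Qed.

(** Points of the box stay inside for large [k] because it is open; points outside, even on the
    boundary, stay outside for all [k] by [boxes_shrink]. *)
Lemma box_indic_cvg Q (t : n.-tuple R) : boxes Q ->
  (fun k => \1_Q (dilation (1 + k.+1%:R^-1) t) : R) @ \oo --> (\1_Q t : R).
Proof.
move=> [a [b [a0 b0 ->]]].
have m1 : (fun k => 1 + k.+1%:R^-1 : R) @ \oo --> (1 : R).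
  rewrite -[X in _ --> X]addr0; apply: cvgD; first exact: cvg_cst.
  exact: cvg_harmonic.
have [tQ|tQ] := boolP (t \in box a b).
  rewrite indicE tQ; apply: cvg_near_cst.
  suff : \forall k \near \oo, forall i,
      tnth (dilation (1 + k.+1%:R^-1) t) i \in `]- a i, b i[.
    by apply: filterS => k tk; rewrite indicE mem_set.
  apply: filter_forall => i.
  have ti : (fun k => (1 + k.+1%:R^-1) * tnth t i) @ \oo --> tnth t i.
    by rewrite -[X in _ --> X]mul1r; apply: cvgM => //; exact: cvg_cst.
  move: tQ; rewrite inE => /(_ i); rewrite in_itv/= => /andP[ta tb].
  near=> k; rewrite in_itv/= tnth_mktuple; apply/andP; split; near: k.
    exact: (cvgr_gt _ ti).
  exact: (cvgr_lt _ ti).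
rewrite indicE (negbTE tQ); apply: cvg_near_cst; apply: nearW => k.
rewrite indicE memNset// => tkQ; move/negP: tQ; apply; rewrite inE.
by apply: boxes_shrink tkQ; [exact: boxes_box|rewrite lerDl invr_ge0].
Unshelve. all: by end_near. Qed.

Lemma indic_box_Lfun2 Q : boxes Q -> (\1_Q : n.-tuple R -> R) \in Lfun nu 2%:E.
Proof.
move=> BQ; have mQ := boxes_measurable BQ.
apply/Lfun2P; split; first exact: measurable_indic.
rewrite (eq_integral (EFin \o \1_Q)) => [|x _].
  by rewrite integral_indic// setIT; exact: lebesgueT_boxes_lty.
by rewrite /= indicE; case: (x \in Q); rewrite ?expr1n ?expr0n.
Qed.

Lemma box_integralE Q u : boxes Q -> u \in Lfun nu 2%:E ->
  nu.-integrable Q (EFin \o u) /\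
  (\int[nu]_(x in Q) (u x)%:E = (inner nu \1_Q u)%:E)%E.
Proof.
move=> BQ u2; have mQ := boxes_measurable BQ.
have iQ := Lfun2_mul_integrable (indic_box_Lfun2 BQ) u2.
split.
  have := integrableS measurableT mQ (subsetT _) iQ; apply: eq_integrable => //.
  by move=> x xQ /=; rewrite indicE xQ mul1r.
rewrite /inner /Rintegral fineK ?integrable_fin_num// [LHS]integral_mkcond.
apply: eq_integral => x _; rewrite patchE indicE.
by case: (x \in Q); rewrite ?mul1r ?mul0r.
Qed.

Lemma inner_box_eq0 Q u : boxes Q -> u \in Lfun nu 2%:E ->
  (forall l, 0 < l -> u \o dilation l \in Lfun nu 2%:E) ->
  (forall l m, 0 < l -> 0 < m -> l != m ->
    inner nu (u \o dilation l) (u \o dilation m) = 0) ->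
  inner nu \1_Q u = 0.
Proof.
move=> BQ u2 ul2 ulm; have Q2 := indic_box_Lfun2 BQ.
have mu := Lfun_measurable u2; have mQ := Lfun_measurable Q2.
pose m k : R := 1 + k.+1%:R^-1.
have m1 k : 1 <= m k by rewrite lerDl invr_ge0.
have m0 k : 0 < m k by rewrite (lt_le_trans _ (m1 k)).
have mi0 k : 0 < (m k)^-1 by rewrite invr_gt0.
pose h k x := \1_Q (dilation (m k) x) * u x.
have mh k : measurable_fun [set: _] (h k).
  apply: measurable_funM => //.
  exact: measurableT_comp mQ (measurable_dilation _).
(* The dilation is moved from [u], which need not be continuous, to the indicator, whose dilates
   converge pointwise. *)
have hE k :
    inner nu \1_Q (u \o dilation (m k)^-1) = m k ^+ n * \int[nu]_x h k x.
  have mQk := measurableT_comp mQ (measurable_dilation (m k)).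
  have := inner_dilation (mi0 k) mQk mu.
  rewrite exprVn invrK /inner => <-; apply: eq_Rintegral => x _ /=.
  by rewrite dilationM mulfV ?dilation1// gt_eqF.
have c1 : (fun k => \int[nu]_x h k x) @ \oo --> inner nu \1_Q u.
  apply: fine_cvg; rewrite fineK; last first.
    by apply: integrable_fin_num => //; exact: Lfun2_mul_integrable.
  apply: (@dominated_cvg _ _ _ nu setT measurableT _ _
    (fun x => `|(\1_Q x * u x)%:E|)%E) => //.
  - by move=> k; apply/measurable_EFinP.
  - move=> x _; apply: cvg_EFin; first exact: nearW.
    by apply: cvgMl; exact: box_indic_cvg.
  - by apply: integrable_abse; exact: Lfun2_mul_integrable.
  (* As [m k >= 1], the dilated indicator is at most that of [Q], so [|1_Q u|] dominates. *)
  - move=> k x _; rewrite lee_fin !normrM ler_wpM2r//.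
    rewrite !indicE; have [xQ|_] := boolP (dilation (m k) x \in Q); last first.
      by rewrite normr0 normr_ge0.
    by rewrite mem_set//; apply: boxes_shrink (set_mem xQ).
have c2 : (fun k => \int[nu]_x h k x) @ \oo --> (0 : R).
  have e0 : (fun k => inner nu \1_Q (u \o dilation (m k)^-1)) @ \oo --> (0 : R).
    (* The square norm of the [k]-th dilate is [m k ^+ n * inner nu u u], and [m k <= 2]. *)
    apply: (bessel_cvg0 (C := 2 ^+ n * inner nu u u)) => //.
    - by move=> i; apply: ul2.
    - move=> i j ij; apply: ulm => //; apply: contra ij => /eqP/invr_inj.
      by move=> /addrI/invr_inj/eqP; rewrite eqr_nat eqSS.
    - move=> i; rewrite inner_dilation// exprVn invrK ler_wpM2r ?inner_ge0//.
      rewrite lerXn2r ?nnegrE ?(ltW (m0 i))//.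
      by rewrite -[2]/(1 + 1) lerD2l invf_le1// ler1n.
  apply/norm_cvg0P.
  apply: (@squeeze_cvgr _ _ _ _ (cst 0)
    (fun k => `|inner nu \1_Q (u \o dilation (m k)^-1)|)).
  - apply: nearW => i; rewrite normr_ge0/= hE normrM ler_peMl//.
    by rewrite ger0_norm ?exprn_ge0 ?(ltW (m0 i))// exprn_ege1.
  - exact: cvg_cst.
  - by rewrite -(normr0 R); exact: cvg_norm.
exact: (cvg_unique _ c1 c2).
Qed.

End box_integrals.

(** * The eigenvalue zero *)

Section zero_energy.
Context {R : realType} {N : nat} (N1 : (1 <= N)%N).
Local Notation nu := (lebesgueT R N).

(** Cubes of side [2 * k] have volume at least [2 * k]. This rests on [N >= 1]: in dimension zero
    the measure is a Dirac mass. *)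
Lemma lebesgueT_setT : nu [set: _] = +oo%E.
Proof.
apply/eqyP => A A0.
pose k := (Num.truncn A).+1%:R : R.
have k0 : 0 < k by rewrite ltr0n.
have mQ : measurable (box (fun=> k) (fun=> k) : set (N.-tuple R)).
  exact: box_measurable.
apply: (@le_trans _ _ (nu (box (fun=> k) (fun=> k)))); last first.
  by apply: le_measure; rewrite ?inE.
rewrite lebesgueT_boxE// lee_fin prodr_const card_ord.
have Ak : A <= k + k by rewrite (le_trans (ltW (truncnS_gt A)))// lerDl ltW.
apply: (le_trans Ak); apply: ler_eXnr => //.
by rewrite (@le_trans _ _ k) ?lerDl ?(ltW k0)// ler1n.
Qed.

(** The density is nonnegative, so the pairs on which [u] differs form a null set. By Fubini some
    section at [x0] is null, that is, [u] equals [u x0] almost everywhere. *)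
Lemma zero_energy_ae (s : R) (u : N.-tuple R -> R) : 0 < s -> Hs N s u ->
  \int[(nu \x nu)%E]_z energy_density s u u z = 0 ->
  {ae nu, forall x, u x = 0}.
Proof.
move=> s0 hu E0.
have /Lfun2P[mu u2] := hu.1.
have iK := integrable_energy_density N1 s0 hu hu.
pose A := [set z : N.-tuple R * N.-tuple R | u z.1 != u z.2].
have mA : measurable A.
  have mu1 : measurable_fun [set: N.-tuple R * N.-tuple R] (u \o fst).
    exact: measurableT_comp.
  have mu2 : measurable_fun [set: N.-tuple R * N.-tuple R] (u \o snd).
    exact: measurableT_comp.
  have mu12 := measurable_funB mu1 mu2.
  rewrite -[A]setTI (_ : A = (fun z => u z.1 - u z.2) @^-1` ~` [set 0]).
    by apply: mu12 => //; exact: measurableC.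
  by apply/seteqP; split => z; rewrite /A/= -subr_eq0 => /eqP.
have K0 : (\int[nu \x nu]_z `|(energy_density s u u z)%:E| = 0)%E.
  rewrite (eq_integral (EFin \o energy_density s u u)).
    by rewrite -[LHS]fineK ?integrable_fin_num//; congr EFin.
  move=> z _; rewrite gee0_abs// lee_fin divr_ge0 ?powR_ge0//.
  by rewrite -expr2 sqr_ge0.
have A0 : ((nu \x nu) A = 0)%E.
  have [/(_ K0) [B [mB B0 AB]] _] :=
    ae_eq_integral_abs (nu \x nu)%E measurableT (measurable_int _ iK).
  (* If the density vanishes at a point of [A], the inverse weight must be zero, which happens only
     on the diagonal; but [A] avoids it. *)
  apply: (subset_measure0 mA mB _ B0) => z Az; apply: AB => /= /(_ I) [] /eqP.
  rewrite mulf_eq0 mulf_eq0 orbb subr_eq0 (negbTE Az)/= invr_eq0.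
  rewrite powR_eq0 => /andP[/eqP /eucl_dist_eq0 z12 _].
  by move: Az; rewrite /A/= z12 eqxx.
have [x0 Ax0] : exists x, nu (xsection A x) = 0%E.
  have mnA : measurable_fun [set: _] (fun x => nu (xsection A x)).
    exact: measurable_fun_xsection.
  have [+ _] := ae_eq_integral_abs nu measurableT mnA.
  have -> : (\int[nu]_x `|nu (xsection A x)| = 0)%E.
    under eq_integral => x _ do rewrite gee0_abs//.
    by [].
  move=> /(_ erefl) [B [mB B0 AB]].
  (* Otherwise the null set [B] would contain the whole space, which has infinite measure. *)
  apply: contrapT => /forallNP noz.
  suff : nu [set: _] = 0%E by rewrite lebesgueT_setT.
  apply: (subset_measure0 measurableT mB _ B0) => x _; apply: AB => /= /(_ I).
  exact: noz.
have ux0 : {ae nu, forall y, u x0 = u y}.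
  exists (xsection A x0); split => //; first exact: measurable_xsection.
  by move=> y /= /eqP uy; rewrite /xsection/= inE.
suff u0 : u x0 = 0 by apply: filterS ux0 => y <-.
apply/eqP; apply/negP => /negP ux00.
move: u2; suff -> : (\int[nu]_x (u x ^+ 2)%:E = +oo)%E by [].
rewrite (ae_eq_integral (cst (u x0 ^+ 2)%:E))//.
- rewrite integral_cst// -[RHS](gt0_muley (x := (u x0 ^+ 2)%:E)).
    by congr (_ * _)%E; exact: lebesgueT_setT.
  by rewrite lte_fin exprn_even_gt0.
- by apply/measurable_EFinP; exact: measurable_funX.
- by apply: filterS ux0 => y /= -> _.
Qed.

End zero_energy.

Theorem proposition1 (R : realType) (N : nat) (s : R)
    (hs : 0 < s < 1) (hN : (1 <= N)%N) (hNs : 2 * s < N%:R)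
    (mu : R) (u : N.-tuple R -> R) (hu : Hs N s u)
    (weak : forall phi : N.-tuple R -> R, Hs N s phi ->
      (\int[lebesgueT R N \x lebesgueT R N]_z
         ((u z.1 - u z.2) * (phi z.1 - phi z.2)
            / eucl_dist z.1 z.2 `^ (N%:R + 2 * s))%:E =
       mu%:E * \int[lebesgueT R N]_x (u x * phi x)%:E)%E) :
  {ae lebesgueT R N, forall x, u x = 0}.
Proof.
have s0 : 0 < s by case/andP: hs.
have u2 := hu.1.
have weakR phi : Hs N s phi ->
    \int[(lebesgueT R N \x lebesgueT R N)%E]_z energy_density s u phi z =
    mu * inner (lebesgueT R N) u phi.
  (* The identity passes from extended to real numbers because the product [u * phi] of L^2
     functions has a finite integral. *)
  move=> hphi; rewrite {1}/Rintegral (weak _ hphi) fineM//.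
  by apply: integrable_fin_num => //; exact: Lfun2_mul_integrable hphi.1.
have [mu0|mu0] := eqVneq mu 0.
  by apply: (zero_energy_ae hN s0 hu); rewrite weakR// mu0 mul0r.
apply: box_integral_eq0_ae; first exact: Lfun_measurable u2.
  by move=> Q BQ; have [] := box_integralE BQ u2.
move=> Q BQ; have [_ ->] := box_integralE BQ u2.
rewrite inner_box_eq0//.
- by move=> l; exact: Lfun2_dilation hu l.
- by move=> l m; exact: (eigenfunction_orthogonal2 hN s0 mu0 hu weakR).
Qed.
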